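(* Fix $M>0$ and $0\le\theta<2s-1$. If $\limsup_{n\to\infty}\Delta_n n^{\frac{4s}{4s+\theta+1}}<\infty$, then $$\liminf_{n\to\infty}\inf_{T\in\mathcal T_n}\big[\mathbb E_{P_0}T+\beta(T;\Delta_n,\theta,M)\big]>0,$$ where $\mathcal T_n$ is the collection of all measurable test functions $T:\mathcal X^n\to[0,1]$ of $X_1,\dots,X_n$.
   Context: Standing setup. $(\mathcal X,\mathcal B)$ is a measurable space and $P_0$ a known probability measure on it. $K$ is a symmetric, positive semidefinite, square-integrable kernel, degenerate under $P_0$, with Mercer decomposition $K(x,x')=\sum_{k\ge1}\lambda_k\varphi_k(x)\varphi_k(x')$, infinitely many eigenvalues $\lambda_1>\lambda_2>\cdots>0$, $\{\varphi_k\}$ an orthonormal basis of the $P_0$-mean-zero functions in $L_2(P_0)$, $0<\liminf_k k^{2s}\lambda_k\le\limsup_k k^{2s}\lambda_k<\infty$ for some $s>1/2$, and $\sup_k\|\varphi_k\|_\infty<\infty$. $\mathcal H(K)$ is the RKHS of $K$, $\|f\|_K^2=\sum_k\lambda_k^{-1}\langle f,\varphi_k\rangle_{L_2(P_0)}^2$. $\mathcal F(\theta;M)$ ($\theta>0$) is the set of $f\in L_2(P_0)$ such that for every $R>0$ there is $f_R\in\mathcal H(K)$ with $\|f_R\|_K\le R$ and $\|f-f_R\|_{L_2(P_0)}\le MR^{-1/\theta}$; $\mathcal F(0;M)=\{f\in\mathcal H(K):\|f\|_K\le M\}$. $\mathcal P(\Delta,\theta,M)$ is the set of probability measures $P\ll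 P_0$ with $u=dP/dP_0-1\in\mathcal F(\theta;M)$ and $\|u\|^2_{L_2(P_0)}\ge\Delta$. Type II error: $\beta(T;\Delta,\theta,M)=\sup_{P\in\mathcal P(\Delta,\theta,M)}\mathbb E_P[1-T(X_1,\dots,X_n)]$ with $X_i$ i.i.d. $P$; $\mathbb E_{P_0}T$ is the type I error. *)

(* Defs.v *)
From HB Require Import structures.
From mathcomp Require Import all_boot all_order all_algebra.
From mathcomp Require Import all_classical all_reals all_analysis.
Set Implicit Arguments.
Unset Strict Implicit.
Unset Printing Implicit Defensive.
Import Order.TTheory GRing.Theory Num.Theory.
Import numFieldNormedType.Exports.
Local Open Scope classical_set_scope.
Local Open Scope ring_scope.

Section Minimax.
Context {d : measure_display} {X : measurableType d} {R : realType}.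

Definition L2 (P0 : probability X R) (f : X -> R) : Prop :=
  measurable_fun setT f /\ (\int[P0]_x ((f x ^+ 2)%:E) < +oo)%E.

Definition L2ip (P0 : probability X R) (f g : X -> R) : R :=
  Rintegral P0 setT (fun x => f x * g x).
Definition L2norm (P0 : probability X R) (f : X -> R) : R :=
  Num.sqrt (Rintegral P0 setT (fun x => f x ^+ 2)).

(* membership in the RKHS H(K), as a subspace of L_2(P0), given the Mercer
   eigen-pairs (lam k, phi k) (index k here corresponds to k+1 in the paper) *)
Definition inRKHS (P0 : probability X R) (lam : nat -> R) (phi : nat -> X -> R)
    (f : X -> R) : Prop :=
  [/\ L2 P0 f, Rintegral P0 setT f = 0 &
      cvgn (series (fun k => (L2ip P0 f (phi k)) ^+ 2 / lam k))].

Definition RKHSnorm (P0 : probability X R) (lam : nat -> R) (phi : nat -> X -> R)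
    (f : X -> R) : R :=
  Num.sqrt (limn (series (fun k => (L2ip P0 f (phi k)) ^+ 2 / lam k))).

Definition Fclass (P0 : probability X R) (lam : nat -> R) (phi : nat -> X -> R)
    (theta M : R) (f : X -> R) : Prop :=
  if theta == 0 then inRKHS P0 lam phi f /\ RKHSnorm P0 lam phi f <= M
  else L2 P0 f /\
    forall r : R, 0 < r -> exists fr : X -> R,
      [/\ inRKHS P0 lam phi fr, RKHSnorm P0 lam phi fr <= r &
          L2norm P0 (fun x => f x - fr x) <= M * r `^ (- (1 / theta))].

Definition Pclass (P0 : probability X R) (lam : nat -> R) (phi : nat -> X -> R)
    (Delta theta M : R) (P : probability X R) : Prop :=
  exists p : X -> R,
    [/\ measurable_fun setT p, (forall x, 0 <= p x),
        (forall A, measurable A -> P A = (\int[P0]_(x in A) (p x)%:E)%E),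
        Fclass P0 lam phi theta M (fun x => p x - 1) &
        Delta <= L2norm P0 (fun x => p x - 1) ^+ 2].

Definition tuple_cyl (n : nat) : set (set (n.-tuple X)) :=
  [set S | exists (i : 'I_n) (A : set X), measurable A /\
           S = [set t | A (tnth t i)]].
Definition tuple_measurable (n : nat) (S : set (n.-tuple X)) : Prop :=
  <<s (@tuple_cyl n) >> S.

Definition test_fun (n : nat) (T : n.-tuple X -> R) : Prop :=
  (forall t, 0 <= T t <= 1) /\
  (forall B : set R, measurable B -> tuple_measurable (T @^-1` B)).

(* E_P[F(X_1,...,X_n)] for X_i i.i.d. P, as the iterated integral against P^n
   (equal to the integral against the product measure, by Tonelli) *)
Fixpoint iter_int (P : probability X R) (n : nat) :
    (n.-tuple X -> \bar R) -> \bar R :=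
  match n return (n.-tuple X -> \bar R) -> \bar R with
  | 0 => fun F => F [tuple]
  | m.+1 => fun F => (\int[P]_x iter_int P (fun t => F (cons_tuple x t)))%E
  end.

Definition typeII (P0 : probability X R) (lam : nat -> R) (phi : nat -> X -> R)
    (n : nat) (T : n.-tuple X -> R) (Delta theta M : R) : \bar R :=
  ereal_sup [set iter_int P (fun t => (1 - T t)%:E) |
             P in Pclass P0 lam phi Delta theta M].

Definition minimax_risk (P0 : probability X R) (lam : nat -> R) (phi : nat -> X -> R)
    (n : nat) (Delta theta M : R) : \bar R :=
  ereal_inf [set (iter_int P0 (fun t => (T t)%:E) + typeII P0 lam phi T Delta theta M)%E
            | T in @test_fun n].

End Minimax.

(* Main.v *)
(** For signs [xi] in {-1,1}^N put [p_xi = 1 + a (xi_1 phi_1 + ... + xi_N phi_N)],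
    with [a^2 N = C n^(-4s/L)], [L = 4s + theta + 1] and [N ~ A n^(2(1+theta)/L)].
    Since [theta < 2s - 1], [a N] tends to 0, so [p_xi] is eventually a density; as
    [|p_xi - 1|_K^2 <= a^2 N / lam_N], a small [A] puts [p_xi - 1] in
    F(theta; M), approximated by itself on large balls and by 0 on small ones.
    For the likelihood ratio [g] of the uniform mixture of the [p_xi^n],
    [E_0 g^2] is the average of [(1 + a^2 <xi, eta>)^n] over pairs of signs, at most
    [cosh (n a^2) ^ N], which is bounded uniformly in [n] by some [D]. Finally
    [T + (1 - T) g >= 2 b g - b^2 g^2] pointwise for every test [T] and
    [0 <= b <= 1/2]; integrating under [P0^n] with [b = 1/(2D)] bounds the risk
    below by [3/(4D)]. *)

Require Import Defs.
From HB Require Import structures.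
From mathcomp Require Import all_boot all_order all_algebra.
From mathcomp Require Import all_classical all_reals all_analysis.
From mathcomp Require Import measurable_realfun ring lra.
Import Order.TTheory GRing.Theory Num.Theory.
Import numFieldNormedType.Exports.
Local Open Scope classical_set_scope.
Local Open Scope ring_scope.

(** * Iterated integrals and densities *)

Section IterInt.
Set Implicit Arguments.
Unset Strict Implicit.
Unset Printing Implicit Defensive.
Context {d : measure_display} {X : measurableType d} {R : realType}.
Implicit Types (P : probability X R) (n : nat).
Local Open Scope ereal_scope.

(** Coordinate cylinders are preimages under the measurable maps [tnth], so the sigma-algebra they
    generate lies inside the measurable sets of the tuple type. *)
Lemma test_fun_measurable n (T : n.-tuple X -> R) :
  test_fun T -> measurable_fun setT T.
Proof.
move=> [_ mT] _ B mB; rewrite setTI.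
apply: (smallest_sub (@sigma_algebra_measurable _ (n.-tuple X)) _ (mT B mB)).
move=> _ [i [A [mA ->]]].
by rewrite -[X in measurable X]setTI; exact: measurable_tnth.
Qed.

Lemma iter_int_ge0 P n (F : n.-tuple X -> \bar R) :
  (forall t, 0 <= F t) -> 0 <= iter_int P F.
Proof.
elim: n F => [|n IH] F F0 /=; first exact: F0.
by apply: integral_ge0 => x _; apply: IH => t; exact: F0.
Qed.

Lemma eq_iter_int P n (F G : n.-tuple X -> \bar R) :
  F =1 G -> iter_int P F = iter_int P G.
Proof. by move=> /funext ->. Qed.

(* The parameter [y] carries the induction on [n] through Tonelli, without
   constructing the product measure on tuples. *)
Lemma measurable_iter_int P n d' (Y : measurableType d')
    (G : Y * n.-tuple X -> \bar R) :
  measurable_fun setT G -> (forall z, 0 <= G z) ->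
  measurable_fun setT (fun y => iter_int P (fun t => G (y, t))).
Proof.
elim: n d' Y G => [|n IH] d' Y G mG G0 /=.
  have mpr := pair2_measurable ([tuple] : 0.-tuple X) (T1 := Y).
  exact: (measurableT_comp mG mpr).
(* The first coordinate joins the parameter, so the induction hypothesis applies over [Y * X];
   Tonelli then integrates that coordinate out. *)
pose H (z : Y * X) := iter_int P (fun t => G (z.1, cons_tuple z.2 t)).
have mH : measurable_fun setT H.
  apply: (IH _ (Y * X)%type (fun w => G (w.1.1, cons_tuple w.1.2 w.2))) => //.
  apply: (measurableT_comp mG); apply/measurable_fun_pairP; split => /=.
    exact: (measurableT_comp (@measurable_fst _ _ Y X)
      (@measurable_fst _ _ (Y * X)%type (n.-tuple X))).
  apply: (@measurable_cons _ _ _ _ (fun w : (Y * X) * n.-tuple X => w.1.2) n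
    (fun w => w.2)) => //.
    exact: (measurableT_comp (@measurable_snd _ _ Y X)
      (@measurable_fst _ _ (Y * X)%type (n.-tuple X))).
  exact: (@measurable_snd _ _ (Y * X)%type (n.-tuple X)).
have H0 z : 0 <= H z by exact: iter_int_ge0.
exact: (@measurable_fun_fubini_tonelli_F _ _ Y X R P H mH H0).
Qed.

Lemma measurable_cons_tuple n (F : n.+1.-tuple X -> \bar R) :
  measurable_fun setT F ->
  measurable_fun setT (fun z : X * n.-tuple X => F (cons_tuple z.1 z.2)).
Proof.
move=> mF; apply: (measurableT_comp mF).
exact: (@measurable_cons _ _ _ _ fst n snd).
Qed.

Lemma measurable_cons_tuple1 n (F : n.+1.-tuple X -> \bar R) x :
  measurable_fun setT F -> measurable_fun setT (fun t => F (cons_tuple x t)).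
Proof.
move=> mF.
exact: (measurableT_comp (measurable_cons_tuple mF) (pair1_measurable x)).
Qed.

Lemma measurable_iter_int_cons P n (F : n.+1.-tuple X -> \bar R) :
  measurable_fun setT F -> (forall t, 0 <= F t) ->
  measurable_fun setT (fun x => iter_int P (fun t => F (cons_tuple x t))).
Proof.
move=> mF F0; apply: (@measurable_iter_int P n _ X
  (fun z => F (cons_tuple z.1 z.2))) => //.
exact: measurable_cons_tuple.
Qed.

Lemma iter_intD P n (F G : n.-tuple X -> \bar R) :
  measurable_fun setT F -> (forall t, 0 <= F t) ->
  measurable_fun setT G -> (forall t, 0 <= G t) ->
  iter_int P (fun t => F t + G t) = iter_int P F + iter_int P G.
Proof.
elim: n F G => [//|n IH] F G mF F0 mG G0 /=.
rewrite -ge0_integralD//; first last.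
- exact: measurable_iter_int_cons.
- by move=> x _; exact: iter_int_ge0.
- exact: measurable_iter_int_cons.
- by move=> x _; exact: iter_int_ge0.
by apply: eq_integral => x _; apply: IH => //; exact: measurable_cons_tuple1.
Qed.

Lemma iter_intZl P n (F : n.-tuple X -> \bar R) (k : R) : (0 <= k)%R ->
  measurable_fun setT F -> (forall t, 0 <= F t) ->
  iter_int P (fun t => k%:E * F t) = k%:E * iter_int P F.
Proof.
move=> k0; elim: n F => [//|n IH] F mF F0 /=.
rewrite -ge0_integralZl//; first last.
- by move=> x _; exact: iter_int_ge0.
- exact: measurable_iter_int_cons.
by apply: eq_integral => x _; apply: IH => //; exact: measurable_cons_tuple1.
Qed.

Lemma le_iter_int P n (F G : n.-tuple X -> \bar R) :
  measurable_fun setT F -> (forall t, 0 <= F t) ->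
  measurable_fun setT G -> (forall t, F t <= G t) ->
  iter_int P F <= iter_int P G.
Proof.
elim: n F G => [|n IH] F G mF F0 mG FG /=; first exact: FG.
have G0 t : 0 <= G t by exact: le_trans (F0 t) (FG t).
apply: ge0_le_integral => //.
- by move=> x _; exact: iter_int_ge0.
- exact: measurable_iter_int_cons.
- exact: measurable_iter_int_cons.
by move=> x _; apply: IH => //; exact: measurable_cons_tuple1.
Qed.

Lemma iter_int_sum P n (I : Type) (r : seq I) (F : I -> n.-tuple X -> \bar R) :
  (forall i, measurable_fun setT (F i)) -> (forall i t, 0 <= F i t) ->
  iter_int P (fun t => \sum_(i <- r) F i t) = \sum_(i <- r) iter_int P (F i).
Proof.
move=> mF F0; elim: r => [|i r IH].
  rewrite big_nil.
  under eq_iter_int do rewrite big_nil.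
  (* The empty sum is the case [k = 0] of the scaling rule. *)
  rewrite -[RHS](mul0e (iter_int P (fun t : n.-tuple X => 0))) -iter_intZl//.
  by apply: eq_iter_int => t; rewrite mul0e.
rewrite big_cons -IH -iter_intD//.
- by apply: eq_iter_int => t; rewrite big_cons.
- exact: emeasurable_sum.
- by move=> t; exact: sume_ge0.
Qed.

(** When [f] is the density of [P] with respect to [P0], this is the likelihood ratio of an i.i.d.
    sample. *)
Definition prodt (f : X -> R) n (t : n.-tuple X) : R :=
  (\prod_(i < n) f (tnth t i))%R.

Lemma prodt_cons n f x (t : n.-tuple X) :
  prodt f (cons_tuple x t) = (f x * prodt f t)%R.
Proof.
rewrite /prodt big_ord_recl tnth0; congr (_ * _)%R.
by apply: eq_bigr => i _; rewrite tnthS.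
Qed.

Lemma prodt_ge0 n f (t : n.-tuple X) :
  (forall x, 0 <= f x)%R -> (0 <= prodt f t)%R.
Proof. by move=> f0; apply: prodr_ge0. Qed.

Lemma measurable_prodt n f : measurable_fun setT f ->
  measurable_fun setT (@prodt f n).
Proof.
move=> mf; apply: measurable_prod => i _.
by apply: (measurableT_comp mf); exact: measurable_tnth.
Qed.

Lemma iter_int_prodt P n (f : X -> R) :
  measurable_fun setT f -> (forall x, 0 <= f x)%R ->
  iter_int P (fun t : n.-tuple X => (prodt f t)%:E) =
    (\int[P]_x (f x)%:E) ^+ n.
Proof.
move=> mf f0; elim: n => [|n IH]; first by rewrite /prodt /= big_ord0.
have mP : measurable_fun setT (fun t : n.-tuple X => (prodt f t)%:E).
  by apply/measurable_EFinP; exact: measurable_prodt.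
have P0 (t : n.-tuple X) : 0 <= (prodt f t)%:E.
  by rewrite lee_fin; exact: prodt_ge0.
rewrite expeS -ge0_integralZr//.
- apply: eq_integral => x _; rewrite -/(iter_int _ _) /=.
  rewrite -IH -iter_intZl//.
  by apply: eq_iter_int => t; rewrite prodt_cons EFinM.
- exact/measurable_EFinP.
- by move=> x _; rewrite lee_fin.
- by apply: expe_ge0; apply: integral_ge0 => x _; rewrite lee_fin.
Qed.

(** * Change of measure through a density *)

Section Density.
Variables (P P0 : probability X R) (p : X -> R).
Hypotheses (mp : measurable_fun setT p) (p0 : forall x, (0 <= p x)%R).
Hypothesis (Pp : forall A, measurable A -> P A = \int[P0]_(x in A) (p x)%:E).

(** [P] is dominated by [P0] because [p] integrates to 0 over null sets, and the change of variables
    formula holds for the Radon-Nikodym derivative, which [p] represents. *)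
Lemma integral_density (f : X -> \bar R) :
  measurable_fun setT f -> (forall x, 0 <= f x) ->
  \int[P]_x f x = \int[P0]_x ((p x)%:E * f x).
Proof.
move=> mf f0.
have PP0 : P `<< P0.
  apply/null_content_dominatesP => A mA A0; rewrite Pp//.
  by apply: null_set_integral => //; apply/measurable_EFinP/measurable_funTS.
have ip : P0.-integrable setT (EFin \o p).
  apply/integrableP; split; first exact/measurable_EFinP.
  under eq_integral do rewrite /= ger0_norm//.
  by rewrite -Pp// probability_setT ltry.
rewrite -(Radon_Nikodym_SigmaFinite.change_of_variables PP0)//.
have irn := Radon_Nikodym_SigmaFinite.f_integrable PP0.
apply: ge0_ae_eq_integral => //.
- by apply: emeasurable_funM => //; exact: measurable_int irn.
- by apply: emeasurable_funM => //; exact/measurable_EFinP.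
- by move=> x _; rewrite mule_ge0//; exact: Radon_Nikodym_SigmaFinite.f_ge0.
- by move=> x _; rewrite mule_ge0// lee_fin.
(* [p] is almost everywhere the Radon-Nikodym derivative. *)
have : ae_eq P0 setT (EFin \o p) (Radon_Nikodym_SigmaFinite.f P P0).
  apply: integral_ae_eq => //; first exact: measurable_int irn.
  move=> E _ mE; rewrite -(Radon_Nikodym_SigmaFinite.f_integral PP0 mE).
  exact/esym/Pp.
apply: filterS => x pf _.
by rewrite -(pf I) /= muleC.
Qed.

(** One coordinate at a time: [integral_density] treats the outer integral, the induction hypothesis
    the inner ones, and the constant [p x] moves inside by [iter_intZl]. *)
Lemma iter_int_density n (F : n.-tuple X -> \bar R) :
  measurable_fun setT F -> (forall t, 0 <= F t) ->
  iter_int P F = iter_int P0 (fun t => (prodt p t)%:E * F t).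
Proof.
elim: n F => [|n IH] F mF F0 /=; first by rewrite /prodt big_ord0 mul1e.
rewrite integral_density//.
- apply: eq_integral => x _; rewrite IH//; last exact: measurable_cons_tuple1.
  rewrite -iter_intZl//.
  + by apply: eq_iter_int => t; rewrite prodt_cons EFinM muleA.
  + apply: emeasurable_funM; last exact: measurable_cons_tuple1.
    by apply/measurable_EFinP; exact: measurable_prodt.
  + by move=> t; rewrite mule_ge0// lee_fin prodt_ge0.
- exact: measurable_iter_int_cons.
- by move=> x; exact: iter_int_ge0.
Qed.

End Density.
End IterInt.

(** * Bayes risk against a mixture *)

Section Mixture.
Set Implicit Arguments.
Unset Strict Implicit.
Unset Printing Implicit Defensive.

(* Replaces the total variation bound: it stays nontrivial (take [b] small) however
   large the second moment of the likelihood ratio [g] is. *)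
Lemma two_point_bound (R : realFieldType) (t g b : R) :
  0 <= t <= 1 -> 0 <= g -> 0 <= b <= 1 / 2 ->
  2 * b * g <= t + (1 - t) * g + b ^+ 2 * g ^+ 2.
Proof.
move=> /andP[t0 t1] g0 /andP[b0 b1]; rewrite -subr_ge0.
(* Both terms are nonnegative; [b <= 1 / 2] enters through [1 - 2 * b >= 0]. *)
rewrite [leRHS](_ : _ = t * (1 - b * g) ^+ 2 +
  (1 - t) * (g * (1 - 2 * b + b ^+ 2 * g))); last by ring.
apply: addr_ge0; first by rewrite mulr_ge0// sqr_ge0.
rewrite mulr_ge0 ?subr_ge0// mulr_ge0// addr_ge0//; first by lra.
by rewrite mulr_ge0// sqr_ge0.
Qed.

Context {d : measure_display} {X : measurableType d} {R : realType}.
Local Open Scope ereal_scope.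

Lemma prodtM (f g : X -> R) n (t : n.-tuple X) :
  prodt (fun x => f x * g x)%R t = (prodt f t * prodt g t)%R.
Proof. by rewrite /prodt -big_split. Qed.

(** This is [two_point_bound] integrated under the null: [g] has mean 1, [(1 - T) g] integrates to
    the average type II error, and [g ^+ 2] expands over pairs of densities, each term factoring
    over the sample. *)
Lemma mixture_testing_bound (P0 : probability X R) (I : finType)
    (P : I -> probability X R) (p : I -> X -> R) (n : nat)
    (T : n.-tuple X -> R) (b : R) :
  (forall i, measurable_fun setT (p i)) -> (forall i x, (0 <= p i x)%R) ->
  (forall i A, measurable A -> P i A = \int[P0]_(x in A) (p i x)%:E) ->
  (0 < #|I|)%N -> test_fun T -> (0 <= b <= 1 / 2)%R ->
  (2 * b)%:E <= iter_int P0 (fun t => (T t)%:E) +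
    \sum_i (#|I|%:R^-1)%:E * iter_int (P i) (fun t => (1 - T t)%:E) +
    \sum_i \sum_j (b ^+ 2 * #|I|%:R^-2)%:E *
      (\int[P0]_x (p i x * p j x)%:E) ^+ n.
Proof.
move=> mp p0 Pp I0 tT bb; set K : R := #|I|%:R.
have K0 : (0 < K)%R by rewrite ltr0n.
have mT : measurable_fun setT T := test_fun_measurable tT.
have [T01 _] := tT.
have mpt i : measurable_fun setT (@prodt d X R (p i) n) by exact: measurable_prodt.
have pt0 i (t : n.-tuple X) : (0 <= prodt (p i) t)%R by exact: prodt_ge0.
have T0 t : (0 <= T t)%R by case/andP: (T01 t).
have T1 t : (0 <= 1 - T t)%R by rewrite subr_ge0; case/andP: (T01 t).
have m1T : measurable_fun setT (fun t => 1 - T t)%R by exact: measurable_funB.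
(* The likelihood ratio of the uniform mixture of the product measures. *)
pose g (t : n.-tuple X) : R := (\sum_i K^-1 * prodt (p i) t)%R.
have g0 t : (0 <= g t)%R.
  by apply: sumr_ge0 => i _; rewrite mulr_ge0// invr_ge0 ltW.
have K10 : (0 <= K^-1)%R by rewrite invr_ge0 ltW.
have mg : measurable_fun setT g.
  by apply: measurable_sum => i; exact: measurable_funM.
have Eg : iter_int P0 (fun t => (g t)%:E) = 1.
  under eq_iter_int do rewrite /g -sumEFin.
  rewrite iter_int_sum; first last.
  - by move=> i t; rewrite lee_fin mulr_ge0.
  - by move=> i; apply/measurable_EFinP; exact: measurable_funM.
  rewrite (eq_bigr (fun=> (K^-1)%:E)) => [|i _].
    by rewrite sumEFin sumr_const -mulr_natl mulfV// gt_eqF.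
  under eq_iter_int do rewrite EFinM.
  rewrite iter_intZl//; [|exact/measurable_EFinP|by move=> t; rewrite lee_fin].
  rewrite iter_int_prodt// -Pp// probability_setT.
  by rewrite -EFin_expe expr1n mule1.
have -> : (2 * b)%:E = iter_int P0 (fun t => (2 * b * g t)%:E).
  under eq_iter_int do rewrite EFinM.
  rewrite iter_intZl//.
  - by rewrite Eg mule1.
  - by case/andP: bb => b0 _; rewrite mulr_ge0.
  - exact/measurable_EFinP.
rewrite [X in X + _](_ : _ = iter_int P0 (fun t => (T t + (1 - T t) * g t)%:E)).
  rewrite [X in _ + X](_ : _ = iter_int P0 (fun t => (b ^+ 2 * g t ^+ 2)%:E)).
    rewrite -iter_intD.
    - apply: le_iter_int.
      + by apply/measurable_EFinP; apply: measurable_funM.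
      + by move=> t; case/andP: bb => b0 _; rewrite lee_fin !mulr_ge0.
      + apply: emeasurable_funD; apply/measurable_EFinP.
          by apply: measurable_funD => //; exact: measurable_funM.
        by apply: measurable_funM => //; exact: measurable_funX.
      + by move=> t; rewrite -EFinD lee_fin two_point_bound.
    - apply/measurable_EFinP.
      by apply: measurable_funD => //; exact: measurable_funM.
    - by move=> t; rewrite lee_fin addr_ge0// mulr_ge0.
    - apply/measurable_EFinP.
      by apply: measurable_funM => //; exact: measurable_funX.
    - by move=> t; rewrite lee_fin mulr_ge0// sqr_ge0.
  have c0 : (0 <= b ^+ 2 * K^-2)%R.
    by rewrite mulr_ge0 ?sqr_ge0// invr_ge0 sqr_ge0.
  have mpp i j : measurable_fun setT (fun x => p i x * p j x)%R.
    exact: measurable_funM.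
  (* The product of two product densities is again of the form [prodt], so its integral is an [n]-th
     power. *)
  transitivity (iter_int P0 (fun t : n.-tuple X => \sum_i \sum_j
      ((b ^+ 2 * K^-2)%R * prodt (fun x => p i x * p j x)%R t)%:E)).
    rewrite iter_int_sum.
    - apply: eq_bigr => i _; rewrite iter_int_sum.
      + apply: eq_bigr => j _; rewrite -iter_int_prodt//; last first.
          by move=> x; rewrite mulr_ge0.
        rewrite -iter_intZl//; first by apply/measurable_EFinP; exact: measurable_prodt.
        by move=> t; rewrite lee_fin prodt_ge0// => x; rewrite mulr_ge0.
      + by move=> j; apply/measurable_EFinP; apply: measurable_funM => //;
          exact: measurable_prodt.
      + by move=> j t; rewrite lee_fin mulr_ge0// prodt_ge0// => x; rewrite mulr_ge0.
    - move=> i; apply: emeasurable_sum => j.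
      by apply/measurable_EFinP; apply: measurable_funM => //; exact: measurable_prodt.
    - move=> i t; apply: sume_ge0 => j _.
      by rewrite lee_fin mulr_ge0// prodt_ge0// => x; rewrite mulr_ge0.
  apply: eq_iter_int => t.
  under eq_bigr do rewrite sumEFin; rewrite sumEFin; congr EFin.
  have sq : ((\sum_i prodt (p i) t) ^+ 2 =
      \sum_i \sum_j prodt (p i) t * prodt (p j) t)%R.
    by rewrite expr2 mulr_suml; apply: eq_bigr => i _; rewrite mulr_sumr.
  rewrite /g -mulr_sumr exprMn mulrA -exprVn sq mulr_sumr.
  apply: eq_bigr => i _; rewrite !mulr_sumr; apply: eq_bigr => j _.
  by rewrite prodtM.
(* Each type II error is rewritten as an integral under [P0] weighted by the product density. *)
transitivity (iter_int P0 (fun t : n.-tuple X => (T t)%:E +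
   \sum_i (K^-1 * (prodt (p i) t * (1 - T t)))%:E)).
  rewrite iter_intD.
  - rewrite iter_int_sum.
    + congr (_ + _); apply: eq_bigr => i _.
      rewrite (iter_int_density (mp i) (p0 i) (Pp i))//.
      * rewrite -iter_intZl//.
        - apply: emeasurable_funM; first exact/measurable_EFinP.
          exact/measurable_EFinP.
        - by move=> t; rewrite -EFinM lee_fin mulr_ge0.
      * exact/measurable_EFinP.
    + move=> i; apply/measurable_EFinP; apply: measurable_funM => //.
      exact: measurable_funM.
    + by move=> i t; rewrite lee_fin !mulr_ge0.
  - exact/measurable_EFinP.
  - by move=> t; rewrite lee_fin.
  - apply: emeasurable_sum => i; apply/measurable_EFinP.
    by apply: measurable_funM => //; exact: measurable_funM.
  - by move=> t; apply: sume_ge0 => i _; rewrite lee_fin !mulr_ge0.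
apply: eq_iter_int => t; rewrite sumEFin -EFinD; congr (_ + _)%:E.
rewrite /g mulr_sumr; apply: eq_bigr => i _; ring.
Qed.

End Mixture.

(** * Moment bounds for sums of random signs *)

Section Rademacher.
Set Implicit Arguments.
Unset Strict Implicit.
Unset Printing Implicit Defensive.
Variable R : realType.
Implicit Types (c : R) (N : nat).

(** A weak form of [cosh c <= exp (c^2 / 2)] using only [1 + x <= exp x]: this gives
    [exp x <= 1 / (1 - x)], the two bounds add up to [2 / (1 - c^2)], and that is at most
    [2 (1 + 2 c^2)] for small [c]. *)
Lemma cosh_le c : `|c| <= 1 / 2 -> expR c + expR (- c) <= 2 * expR (2 * c ^+ 2).
Proof.
rewrite ler_norml => /andP[c1 c2].
have lec x : x < 1 -> expR x <= (1 - x)^-1 :> R.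
  move=> x1; rewrite -[X in expR X]opprK expRN lef_pV2 ?posrE ?expR_gt0 ?subr_gt0//.
  exact: expR_ge1Dx.
have h1 : expR c <= (1 - c)^-1 by apply: lec; lra.
have h2 : expR (- c) <= (1 - - c)^-1 by apply: lec; lra.
have c4 : c ^+ 2 <= 1 / 4 by nra.
have d0 : (0 < 1 - c) by lra.
have d1 : (0 < 1 + c) by lra.
have h3 : (1 - c)^-1 + (1 - - c)^-1 <= 2 * (1 + 2 * c ^+ 2).
  rewrite opprK -subr_ge0.
  have -> : 2 * (1 + 2 * c ^+ 2) - ((1 - c)^-1 + (1 + c)^-1) =
     2 * c ^+ 2 * (1 - 2 * c ^+ 2) / ((1 - c) * (1 + c)).
    by field; rewrite !gt_eqF.
  apply: divr_ge0; last by apply: mulr_ge0; lra.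
  by apply: mulr_ge0; [rewrite mulr_ge0// sqr_ge0|lra].
by apply: le_trans (lerD h1 h2) (le_trans h3 _); rewrite ler_pM2l ?expR_ge1Dx.
Qed.

(** Signs are coded by booleans, [true] being -1, so that sign vectors form a finite type that can
    index the mixture. *)
Definition rsgn (b : bool) : R := (-1) ^+ b.

Definition rdot N (xi eta : {ffun 'I_N -> bool}) : R :=
  \sum_(k < N) rsgn (xi k) * rsgn (eta k).

(** The exponential of a sum is a product, and summing it over all sign vectors factors into one
    two-term sum per coordinate. Whatever [xi k] is, these two terms are [exp c] and [exp (- c)]. *)
Lemma rademacher_mgf N c (xi : {ffun 'I_N -> bool}) : `|c| <= 1 / 2 ->
  \sum_(eta : {ffun 'I_N -> bool}) expR (c * rdot xi eta) <=
    2 ^+ N * expR (2 * c ^+ 2 * N%:R).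
Proof.
move=> c12.
under eq_bigr do rewrite /rdot mulr_sumr expR_sum.
rewrite -(bigA_distr_bigA (fun k b => expR (c * (rsgn (xi k) * rsgn b)))).
rewrite expRM_natr -exprMn.
rewrite -[N in leRHS]card_ord -prodr_const.
apply: ler_prod => k _; rewrite sumr_ge0/=; last by move=> *; exact: expR_ge0.
apply: le_trans (cosh_le c12).
rewrite big_bool /rsgn /=.
by case: (xi k); rewrite ?expr0 ?expr1 ?mulr1 ?mul1r ?mulrNN ?mulrN ?mulr1 ?mulr1// addrC.
Qed.

(** By [1 + x <= exp x] the power is at most [exp (n a2 <xi, eta>)]; nonnegativity of the base is
    what allows raising this inequality to the power [n]. The bound no longer depends on [xi],
    whence the second factor [2 ^+ N]. *)
Lemma rademacher_chi2 N n (a2 : R) : `|n%:R * a2| <= 1 / 2 ->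
  (forall xi eta : {ffun 'I_N -> bool}, 0 <= 1 + a2 * rdot xi eta) ->
  \sum_(xi : {ffun 'I_N -> bool}) \sum_(eta : {ffun 'I_N -> bool})
     (1 + a2 * rdot xi eta) ^+ n <=
    4 ^+ N * expR (2 * (n%:R * a2) ^+ 2 * N%:R).
Proof.
move=> c12 ge0.
apply: (@le_trans _ _ (\sum_(xi : {ffun 'I_N -> bool})
    2 ^+ N * expR (2 * (n%:R * a2) ^+ 2 * N%:R))).
  apply: ler_sum => xi _; apply: le_trans (rademacher_mgf xi c12).
  apply: ler_sum => eta _; rewrite -mulrA expRM_natl.
  by rewrite lerXn2r ?nnegrE ?expR_ge0// expR_ge1Dx.
rewrite sumr_const card_ffun card_bool card_ord -[leLHS]mulr_natl natrX mulrA.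
by rewrite -exprMn -natrM.
Qed.

End Rademacher.

(** * Sign perturbations of the null *)

Section DensityProbability.
Set Implicit Arguments.
Unset Strict Implicit.
Unset Printing Implicit Defensive.
Context {d : measure_display} {X : measurableType d} {R : realType}.
Variable P0 : probability X R.

Lemma density_probability (p : X -> R) :
  measurable_fun setT p -> (forall x, 0 <= p x) ->
  (\int[P0]_x (p x)%:E = 1)%E ->
  exists P : probability X R,
    forall A, measurable A -> P A = (\int[P0]_(x in A) (p x)%:E)%E.
Proof.
move=> mp p0 p1.
pose mu (A : set X) := (\int[P0]_(x in A) (p x)%:E)%E.
have mu0 : mu set0 = 0%E by rewrite /mu integral_set0.
have mu_ge0 A : (0 <= mu A)%E by apply: integral_ge0 => x _; rewrite lee_fin.
have mu_sigma : semi_sigma_additive mu.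
  move=> F mF tF mUF; rewrite /mu ge0_integral_bigcup//.
  - apply: is_cvg_ereal_nneg_natsum => n _.
    by apply: integral_ge0 => x _; rewrite lee_fin.
  - by apply/measurable_EFinP; exact: measurable_funTS.
  - by move=> x _; rewrite lee_fin.
pose mM := isMeasure.Build d X R mu mu0 mu_ge0 mu_sigma.
pose m : {measure set X -> \bar R} := HB.pack mu mM.
pose P : probability X R :=
  HB.pack mu mM (Measure_isProbability.Build d X R m p1).
by exists P.
Qed.

Lemma bounded_integrable (f : X -> R) (B : R) :
  measurable_fun setT f -> (forall x, `|f x| <= B) ->
  P0.-integrable setT (EFin \o f).
Proof.
move=> mf fB; apply: measurable_bounded_integrable => //.
- exact: le_lt_trans (probability_le1 P0 measurableT) (ltry 1).
- by exists B; split; [exact: num_real|move=> M BM x _ /=; exact: le_trans (fB x) (ltW BM)].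
Qed.

Lemma Rintegral_sum (I : Type) (r : seq I) (f : I -> X -> R) :
  (forall i, P0.-integrable setT (EFin \o f i)) ->
  Rintegral P0 setT (fun x => \sum_(i <- r) f i x) =
    \sum_(i <- r) Rintegral P0 setT (f i).
Proof.
move=> fi; elim: r => [|i r IH].
  rewrite big_nil (@eq_Rintegral _ _ _ _ _ (cst 0)); first by rewrite Rintegral_cst// mul0r.
  by move=> x _; rewrite big_nil.
rewrite big_cons -IH -RintegralD//.
  by apply: eq_Rintegral => x _; rewrite big_cons.
have -> : EFin \o (fun x => \sum_(j <- r) f j x) =
    (fun x => \sum_(j <- r) (EFin \o f j) x)%E.
  by apply/funext => x; rewrite /= sumEFin.
exact: integrable_sum.
Qed.

Lemma Rintegral_cst_probability (r : R) : Rintegral P0 setT (cst r) = r.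
Proof.
rewrite Rintegral_cst// -[RHS]mulr1; congr (_ * _).
exact: (congr1 fine (probability_setT P0)).
Qed.

Lemma ae_eq_Rintegral (f g : X -> R) :
  measurable_fun setT f -> measurable_fun setT g ->
  {ae P0, forall x, f x = g x} -> Rintegral P0 setT f = Rintegral P0 setT g.
Proof.
move=> mf mg fg; rewrite /Rintegral; congr fine.
apply: ae_eq_integral => //; [exact/measurable_EFinP|exact/measurable_EFinP|].
by apply: filterS fg => x + _ => ->.
Qed.

(* The densities must be nonnegative everywhere, while the eigenfunctions are
   bounded only almost everywhere. *)
Lemma bounded_version (phi : nat -> X -> R) (B : R) :
  (forall k, measurable_fun setT (phi k)) ->
  (forall k, {ae P0, forall x, `|phi k x| <= B}) ->
  exists psi : nat -> X -> R,
    [/\ forall k, measurable_fun setT (psi k),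
        forall k x, `|psi k x| <= `|B| &
        forall k, {ae P0, forall x, psi k x = phi k x}].
Proof.
move=> mphi phiB.
(* The absolute value of [B] bounds the replacement value 0 whatever the sign of [B]. *)
exists (fun k x => if `|phi k x| <= B then phi k x else 0); split.
- move=> k; apply: measurable_fun_ifT => //.
  apply: measurable_fun_ler => //.
  exact: measurableT_comp.
- by move=> k x; case: ifPn => [h|_]; [exact: le_trans h (ler_norm _)|rewrite normr0].
- by move=> k; apply: filterS (phiB k) => x ->.
Qed.

End DensityProbability.

(** * Moments and RKHS norm of a sign perturbation *)

Section Perturbation.
Set Implicit Arguments.
Unset Strict Implicit.
Unset Printing Implicit Defensive.
Context {d : measure_display} {X : measurableType d} {R : realType}.
Variables (P0 : probability X R) (phi psi : nat -> X -> R) (B : R).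
Hypotheses (mphi : forall k, measurable_fun setT (phi k))
  (phi_mean0 : forall k, Rintegral P0 setT (phi k) = 0)
  (phi_orth : forall j k, L2ip P0 (phi j) (phi k) = if j == k then 1 else 0).
Hypotheses (mpsi : forall k, measurable_fun setT (psi k))
  (psiB : forall k x, `|psi k x| <= B)
  (psiphi : forall k, {ae P0, forall x, psi k x = phi k x}).
Variables (N : nat) (a : R).
Hypothesis (a0 : 0 <= a).

Let B0 : 0 <= B. Proof. exact: le_trans (psiB 0 point). Qed.

(** Built from the versions [psi], which are bounded everywhere; all integrals agree with those for
    [phi]. *)
Definition pert (xi : {ffun 'I_N -> bool}) (x : X) : R :=
  \sum_(k < N) a * rsgn R (xi k) * psi k x.

Lemma norm_rsgn b : `|rsgn R b| = 1.
Proof. by rewrite /rsgn normrX normrN1 expr1n. Qed.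

Lemma rsgnM b : rsgn R b * rsgn R b = 1.
Proof. by rewrite /rsgn -expr2 sqrr_sign. Qed.

Lemma measurable_pert xi : measurable_fun setT (pert xi).
Proof. by apply: measurable_sum => k; exact: measurable_funM. Qed.

(** Ensures that [1 + pert xi] is nonnegative as soon as [a * N%:R * B <= 1]. *)
Lemma pert_bound xi x : `|pert xi x| <= a * N%:R * B.
Proof.
apply: le_trans (ler_norm_sum _ _ _) _.
apply: (@le_trans _ _ (\sum_(k < N) a * B)).
  apply: ler_sum => k _; rewrite !normrM norm_rsgn mulr1 ger0_norm//.
  exact: ler_wpM2l.
by rewrite sumr_const card_ord -[leLHS]mulr_natr mulrAC.
Qed.

Lemma Rintegral_psi k : Rintegral P0 setT (psi k) = 0.
Proof. by rewrite -(phi_mean0 k); exact: ae_eq_Rintegral. Qed.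

Lemma L2ip_psi_psi j k : L2ip P0 (psi j) (psi k) = (j == k)%:R.
Proof.
have -> : (j == k)%:R = L2ip P0 (phi j) (phi k) by rewrite phi_orth; case: eqP.
rewrite /L2ip; apply: ae_eq_Rintegral; [exact: measurable_funM|exact: measurable_funM|].
by move: (psiphi j) (psiphi k); apply: filterS2 => x -> ->.
Qed.

Lemma integrable_psi k : P0.-integrable setT (EFin \o psi k).
Proof. exact: (bounded_integrable _ (mpsi k) (psiB k)). Qed.

Lemma integrable_psiM j k :
  P0.-integrable setT (EFin \o (fun x => psi j x * psi k x)).
Proof.
apply: (@bounded_integrable _ _ _ _ _ (B * B)).
  exact: measurable_funM.
by move=> x; rewrite normrM ler_pM.
Qed.

Lemma integrable_Zl (c : R) (f : X -> R) :
  P0.-integrable setT (EFin \o f) ->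
  P0.-integrable setT (EFin \o (fun x => c * f x)).
Proof.
move=> fi; have -> : EFin \o (fun x => c * f x) = (fun x => c%:E * (EFin \o f) x)%E.
  by apply/funext => x /=; rewrite EFinM.
exact: integrableZl.
Qed.

Lemma Rintegral_pert xi : Rintegral P0 setT (pert xi) = 0.
Proof.
rewrite Rintegral_sum => [|k]; last exact/integrable_Zl/integrable_psi.
apply: big1 => k _; rewrite RintegralZl//; last exact: integrable_psi.
by rewrite Rintegral_psi mulr0.
Qed.

Lemma L2ip_pert_psi xi k :
  L2ip P0 (pert xi) (psi k) = \sum_(j < N) a * rsgn R (xi j) * (j == k :> nat)%:R.
Proof.
rewrite /L2ip (@eq_Rintegral _ _ _ _ _
    (fun x => \sum_(j < N) a * rsgn R (xi j) * (psi j x * psi k x))); last first.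
  by move=> x _; rewrite /pert mulr_suml; apply: eq_bigr => j _; rewrite mulrA.
rewrite Rintegral_sum => [|j]; last exact/integrable_Zl/integrable_psiM.
apply: eq_bigr => j _; rewrite RintegralZl//; last exact: integrable_psiM.
by congr (_ * _); exact: L2ip_psi_psi.
Qed.

Lemma L2ip_pert_phi xi k :
  L2ip P0 (pert xi) (phi k) = \sum_(j < N) a * rsgn R (xi j) * (j == k :> nat)%:R.
Proof.
rewrite -L2ip_pert_psi /L2ip; apply: ae_eq_Rintegral.
- by apply: measurable_funM => //; exact: measurable_pert.
- by apply: measurable_funM => //; exact: measurable_pert.
- by apply: filterS (psiphi k) => x ->.
Qed.

(** Squaring removes the sign, so the RKHS norm is the same for every [xi]. *)
Lemma L2ip_pert_phi_sqr xi k :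
  L2ip P0 (pert xi) (phi k) ^+ 2 = if (k < N)%N then a ^+ 2 else 0.
Proof.
rewrite L2ip_pert_phi; case: ltnP => kN; last first.
  rewrite big1 ?expr0n// => j _.
  by rewrite ltn_eqF ?mulr0//; exact: leq_trans kN.
rewrite (bigD1 (Ordinal kN))//= eqxx big1 => [|j jk]; last first.
  by rewrite -val_eqE /= in jk; rewrite (negbTE jk) mulr0.
by rewrite addr0 mulr1 exprMn expr2 [X in _ * X]expr2 rsgnM mulr1 -expr2.
Qed.

Lemma L2ip_pert xi eta : L2ip P0 (pert xi) (pert eta) = a ^+ 2 * rdot R xi eta.
Proof.
rewrite /L2ip (@eq_Rintegral _ _ _ _ _
    (fun x => \sum_(k < N) a * rsgn R (eta k) * (pert xi x * psi k x))); last first.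
  by move=> x _; rewrite {2}/pert mulr_sumr; apply: eq_bigr => j _; ring.
have ip k : P0.-integrable setT (EFin \o (fun x => pert xi x * psi k x)).
  apply: (@bounded_integrable _ _ _ _ _ (a * N%:R * B * B)).
    by apply: measurable_funM => //; exact: measurable_pert.
  by move=> x; rewrite normrM ler_pM// pert_bound.
rewrite Rintegral_sum => [|k]; last exact/integrable_Zl.
rewrite /rdot mulr_sumr; apply: eq_bigr => k _; rewrite RintegralZl//.
rewrite [X in _ * X](_ : _ = a * rsgn R (xi k)); first by ring.
rewrite -/(L2ip P0 (pert xi) (psi k)) L2ip_pert_psi (bigD1 k)//= eqxx big1 => [|j jk].
  by rewrite addr0 mulr1.
by rewrite -val_eqE /= in jk; rewrite (negbTE jk) mulr0.
Qed.

Lemma integrable_pert xi : P0.-integrable setT (EFin \o pert xi).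
Proof.
exact: (bounded_integrable _ (measurable_pert xi) (pert_bound xi)).
Qed.

Lemma integrable_pertM xi eta :
  P0.-integrable setT (EFin \o (fun x => pert xi x * pert eta x)).
Proof.
apply: (@bounded_integrable _ _ _ _ _ ((a * N%:R * B) * (a * N%:R * B))).
  by apply: measurable_funM; exact: measurable_pert.
by move=> x; rewrite normrM ler_pM// pert_bound.
Qed.

(** The pairwise term of the chi-square computation for one observation: the linear terms vanish
    because perturbations have mean zero. *)
Lemma integral_pertM xi eta :
  (\int[P0]_x ((1 + pert xi x) * (1 + pert eta x))%:E =
    (1 + a ^+ 2 * rdot R xi eta)%:E)%E.
Proof.
have i1 : P0.-integrable setT (EFin \o (cst 1 : X -> R)).
  by apply: (@bounded_integrable _ _ _ _ _ 1) => // x; rewrite normr1.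
have iu := integrable_pert; have iuu := integrable_pertM xi eta.
have -> : (fun x => ((1 + pert xi x) * (1 + pert eta x))%:E) =
    (EFin \o (fun x => (cst 1 x + pert xi x) + (pert eta x + pert xi x * pert eta x))).
  by apply/funext => x; rewrite /comp /cst; congr EFin; ring.
have i3 : P0.-integrable setT (EFin \o (fun x => cst 1 x + pert xi x)).
  exact: (integrableD _ i1 (iu xi)).
have i4 : P0.-integrable setT (EFin \o (fun x => pert eta x + pert xi x * pert eta x)).
  exact: (integrableD _ (iu eta) iuu).
have i5 : P0.-integrable setT (EFin \o (fun x => (cst 1 x + pert xi x) +
    (pert eta x + pert xi x * pert eta x))).
  exact: (integrableD _ i3 i4).
rewrite -[LHS]fineK; last exact: integrable_fin_num.
congr EFin; rewrite -/(Rintegral _ _ _) RintegralD// RintegralD// RintegralD//.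
rewrite !Rintegral_pert Rintegral_cst_probability -L2ip_pert.
by rewrite addr0 add0r.
Qed.

Lemma integral_1Dpert xi : (\int[P0]_x (1 + pert xi x)%:E = 1)%E.
Proof.
have i1 : P0.-integrable setT (EFin \o (cst 1 : X -> R)).
  by apply: (@bounded_integrable _ _ _ _ _ 1) => // x; rewrite normr1.
have i3 : P0.-integrable setT (EFin \o (fun x => cst 1 x + pert xi x)).
  exact: (integrableD _ i1 (integrable_pert xi)).
rewrite -[LHS]fineK; last exact: integrable_fin_num i3.
congr EFin; rewrite -/(Rintegral _ _ (fun x => cst 1 x + pert xi x)).
rewrite RintegralD//; last exact: integrable_pert.
by rewrite Rintegral_pert Rintegral_cst_probability addr0.
Qed.

Lemma rdotxx (xi : {ffun 'I_N -> bool}) : rdot R xi xi = N%:R.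
Proof.
rewrite /rdot (eq_bigr (fun=> 1)) ?sumr_const ?card_ord// => k _.
by rewrite rsgnM.
Qed.

Lemma L2norm_pert_sqr xi : L2norm P0 (pert xi) ^+ 2 = a ^+ 2 * N%:R.
Proof.
rewrite /L2norm sqr_sqrtr; last by apply: Rintegral_ge0 => x _; exact: sqr_ge0.
by rewrite -(rdotxx xi) -L2ip_pert.
Qed.

(** Only the first [N] coefficients are nonzero, so the series is eventually constant. *)
Lemma pert_inRKHS (lam : nat -> R) xi : (forall k, 0 < lam k) ->
  inRKHS P0 lam phi (pert xi) /\
  RKHSnorm P0 lam phi (pert xi) = Num.sqrt (\sum_(k < N) a ^+ 2 / lam k).
Proof.
move=> lam0.
set u := series (fun k => L2ip P0 (pert xi) (phi k) ^+ 2 / lam k).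
have uN : \forall n \near \oo, u n = \sum_(k < N) a ^+ 2 / lam k.
  exists N => // n /= Nn; rewrite /u /series /=.
  rewrite (big_cat_nat (n := N))//= big_mkord addrC big_nat big1 => [|k /andP[Nk _]].
    by rewrite add0r; apply: eq_bigr => k _; rewrite L2ip_pert_phi_sqr ltn_ord.
  by rewrite L2ip_pert_phi_sqr ltnNge Nk mul0r.
have ucvg : u @ \oo --> \sum_(k < N) a ^+ 2 / lam k.
  exact: cvg_near_cst.
split; last by rewrite /RKHSnorm -/u (cvg_lim _ ucvg).
split.
- split; first exact: measurable_pert.
  have := integrable_pertM xi xi; move/integrableP => [_].
  apply: le_lt_trans; apply: ge0_le_integral => //.
  + by move=> x _; rewrite lee_fin sqr_ge0.
  + by apply/measurable_EFinP; apply: measurable_funX; exact: measurable_pert.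
  + apply: measurableT_comp => //; apply/measurable_EFinP.
    by apply: measurable_funM; exact: measurable_pert.
  + by move=> x _; rewrite /= lee_fin -expr2 ler_norm.
- exact: Rintegral_pert.
- by apply/cvg_ex; eexists; exact: ucvg.
Qed.

End Perturbation.

(** * Membership in the approximation class *)

Section Class.
Set Implicit Arguments.
Unset Strict Implicit.
Unset Printing Implicit Defensive.
Context {d : measure_display} {X : measurableType d} {R : realType}.
Variables (P0 : probability X R) (lam : nat -> R) (phi : nat -> X -> R).

Lemma inRKHS0 : inRKHS P0 lam phi (cst 0) /\ RKHSnorm P0 lam phi (cst 0) = 0.
Proof.
have ip0 k : L2ip P0 (cst 0) (phi k) = 0.
  rewrite /L2ip (@eq_Rintegral _ _ _ _ _ (cst 0)).
    by rewrite Rintegral_cst// mul0r.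
  by move=> x _; rewrite mul0r.
have u0 : series (fun k => L2ip P0 (cst 0) (phi k) ^+ 2 / lam k) = cst 0.
  apply/funext => n; rewrite /series /= big1// => k _.
  by rewrite ip0 expr0n mul0r.
split; last by rewrite /RKHSnorm u0 lim_cst// sqrtr0.
split; [split => //| |by rewrite u0; exact: is_cvg_cst].
  rewrite (eq_integral (cst 0%E)) ?integral0 ?ltry// => x _.
  by rewrite /= expr0n.
by rewrite Rintegral_cst// mul0r.
Qed.

(** For [theta != 0] a single inequality at radius [rho] suffices: radii above [rho] use [u] itself
    with no error, and radii below use 0, where the allowed error is only larger. *)
Lemma Fclass_ball (theta M rho : R) (u : X -> R) :
  0 <= theta -> 0 < M -> 0 < rho ->
  inRKHS P0 lam phi u -> RKHSnorm P0 lam phi u <= rho ->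
  (theta = 0 -> rho <= M) ->
  (theta != 0 -> L2norm P0 u <= M * rho `^ (- (1 / theta))) ->
  Fclass P0 lam phi theta M u.
Proof.
move=> t0 M0 rho0 Hu urho rhoM uM; rewrite /Fclass; case: eqVneq => [te0|tn0].
  by split => //; exact: le_trans urho (rhoM te0).
have t1 : 0 < theta by rewrite lt_neqAle eq_sym tn0.
split=> [|r r0]; first by case: Hu.
have [rhor|rrho] := leP rho r.
  exists u; split => //; first exact: le_trans urho rhor.
  rewrite /L2norm (@eq_Rintegral _ _ _ _ _ (cst 0)).
    by rewrite Rintegral_cst// mul0r sqrtr0 mulr_ge0 ?powR_ge0// ltW.
  by move=> x _; rewrite subrr expr0n.
have [h0 n0] := inRKHS0.
exists (cst 0); split => //; first by rewrite n0 ltW.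
have -> : (fun x => u x - cst 0 x) = u by apply/funext => x; rewrite subr0.
apply: le_trans (uM tn0) _; rewrite ler_pM2l// !powRN.
rewrite lef_pV2 ?posrE ?powR_gt0//.
by apply: ge0_ler_powR; rewrite ?nnegrE ?divr_ge0// ltW.
Qed.

End Class.

(** * Minimax lower bound *)

Section LimInfSup.
Set Implicit Arguments.
Unset Strict Implicit.
Unset Printing Implicit Defensive.
Context {R : realType}.
Local Open Scope ereal_scope.

Lemma limn_einf_sup_einfs (v : (\bar R)^nat) :
  limn_einf v = ereal_sup (range (einfs v)).
Proof.
by rewrite limn_einf_lim; apply/cvg_lim => //; exact: cvg_einfs_sup.
Qed.

Lemma limn_esup_inf_esups (v : (\bar R)^nat) :
  limn_esup v = ereal_inf (range (esups v)).
Proof.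
by rewrite limn_esup_lim; apply/cvg_lim => //; exact: cvg_esups_inf.
Qed.

(** The lower limit is the supremum of the tail infima, so some tail infimum is positive; it is
    finite, being at most a term of the real sequence. *)
Lemma limn_einf_gt0P (u : nat -> R) :
  0 < limn_einf (fun k => (u k)%:E) ->
  exists (c : R) k0, (0 < c)%R /\ forall k, (k0 <= k)%N -> (c <= u k)%R.
Proof.
rewrite limn_einf_sup_einfs => /ereal_sup_gt[_ [k0 _ <-]].
set i := einfs _ _ => i0.
have ilb k : (k0 <= k)%N -> i <= (u k)%:E.
  by move=> kk; apply: ereal_inf_lbound; exists k.
have ifin : i \is a fin_num.
  rewrite fin_numE gt_eqF ?(lt_trans _ i0)//= lt_eqF//.
  by rewrite (le_lt_trans (ilb k0 (leqnn _)))// ltry.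
exists (fine i), k0; split => [|k kk]; first by rewrite fine_gt0// i0 ltey_eq ifin.
by rewrite -lee_fin fineK// ilb.
Qed.

Lemma limn_esup_ltyP (u : nat -> R) :
  limn_esup (fun k => (u k)%:E) < +oo ->
  exists (c : R) k0, forall k, (k0 <= k)%N -> (u k <= c)%R.
Proof.
rewrite limn_esup_inf_esups => /ereal_inf_lt[_ [k0 _ <-]].
set i := esups _ _ => i0.
have iub k : (k0 <= k)%N -> (u k)%:E <= i.
  by move=> kk; apply: ereal_sup_ubound; exists k.
have ifin : i \is a fin_num.
  rewrite fin_numE (lt_eqF i0) andbT gt_eqF//.
  by rewrite (lt_le_trans _ (iub k0 (leqnn _)))// ltNyr.
by exists (fine i), k0 => k kk; rewrite -lee_fin fineK// iub.
Qed.

Lemma le_limn_einf (v : (\bar R)^nat) c k0 :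
  (forall k, (k0 <= k)%N -> c <= v k) -> c <= limn_einf v.
Proof.
move=> cv; rewrite limn_einf_sup_einfs.
apply: (@le_trans _ _ (einfs v k0)); last by apply: ereal_sup_ubound; exists k0.
by apply: le_ereal_inf_tmp => _ [k /= kk <-]; exact: cv.
Qed.

End LimInfSup.

(** * Risk bound at a fixed sample size *)

Section FixedSample.
Set Implicit Arguments.
Unset Strict Implicit.
Unset Printing Implicit Defensive.
Context {d : measure_display} {X : measurableType d} {R : realType}.
Variables (P0 : probability X R) (lam : nat -> R) (phi psi : nat -> X -> R) (B : R).
Hypotheses (mphi : forall k, measurable_fun setT (phi k))
  (phi_mean0 : forall k, Rintegral P0 setT (phi k) = 0)
  (phi_orth : forall j k, L2ip P0 (phi j) (phi k) = if j == k then 1 else 0).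
Hypotheses (mpsi : forall k, measurable_fun setT (psi k))
  (psiB : forall k x, `|psi k x| <= B)
  (psiphi : forall k, {ae P0, forall x, psi k x = phi k x}).

(** The type II error dominates its average over the sign vectors, so the mixture bound applies; [D]
    bounds the second moment of the mixture likelihood ratio. *)
Lemma minimax_risk_ge (n N : nat) (a D Delta theta M : R) :
  0 <= a -> a * N%:R * B <= 1 -> n%:R * a ^+ 2 <= 1 / 2 ->
  1 <= D -> expR (2 * (n%:R * a ^+ 2) ^+ 2 * N%:R) <= D ->
  Delta <= a ^+ 2 * N%:R ->
  (forall xi, Fclass P0 lam phi theta M (@pert _ X R psi N a xi)) ->
  ((3 / 4 / D)%:E <= minimax_risk P0 lam phi n Delta theta M)%E.
Proof.
move=> a0 aN na D1 chiD DeltaN Fpert.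
pose p xi x := 1 + @pert _ X R psi N a xi x.
have mp xi : measurable_fun setT (p xi).
  by apply: measurable_funD => //; exact: measurable_pert.
have p0 xi x : 0 <= p xi x.
  have := le_trans (pert_bound psiB a0 xi x) aN.
  by rewrite ler_norml /p => /andP[+ _]; rewrite -lerBlDl sub0r.
have [P Pp] := choice (fun xi => density_probability (mp xi) (p0 xi)
  (integral_1Dpert mphi phi_mean0 mpsi psiB psiphi a0 xi)).
have PE xi : (Pclass P0 lam phi Delta theta M) (P xi).
  exists (p xi); have pE : (fun x => p xi x - 1) = @pert _ X R psi N a xi.
    by apply/funext => x; rewrite /p addrC addKr.
  split => //; first by move=> A mA; exact: Pp.
    by rewrite pE.
  by rewrite pE (L2norm_pert_sqr mphi phi_orth mpsi psiB psiphi a0).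
apply: le_ereal_inf_tmp => _ [T tT <-].
set S := typeII _ _ _ _ _ _ _.
have PS xi : (iter_int (P xi) (fun t => (1 - T t)%:E) <= S)%E.
  by apply: ereal_sup_ubound; exists (P xi).
have [T01 _] := tT.
have E0 : (0 <= iter_int P0 (fun t => (T t)%:E))%E.
  by apply: iter_int_ge0 => t; rewrite lee_fin; case/andP: (T01 t).
have S0 : (0 <= S)%E.
  apply: le_trans (PS [ffun=> true]).
  by apply: iter_int_ge0 => t; rewrite lee_fin subr_ge0; case/andP: (T01 t).
have D0 : 0 < D by exact: lt_le_trans D1.
(* This maximizes [2 b - b^2 D - b^2 D] up to half its linear term: it gives
   [2 b - b^2 D = 3 / (4 D)], and [b <= 1 / 2] because [1 <= D]. *)
pose b := (2 * D)^-1.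
have b01 : 0 <= b <= 1 / 2.
  rewrite invr_ge0 mulr_ge0 ?(ltW D0)//= /b div1r lef_pV2 ?posrE ?mulr_gt0//.
  by rewrite ler_peMr.
have I0 : (0 < #|{ffun 'I_N -> bool}|)%N.
  by rewrite card_ffun card_bool expn_gt0.
have := mixture_testing_bound mp p0 Pp I0 tT b01.
set K : R := #|_|%:R; set E := iter_int P0 _.
have KE : K = 2 ^+ N by rewrite /K card_ffun card_bool card_ord natrX.
have K0 : 0 < K by rewrite ltr0n.
rewrite [X in (_ + X)%E](_ : _ = (b ^+ 2 * K ^- 2 *
    \sum_(xi : {ffun 'I_N -> bool}) \sum_(eta : {ffun 'I_N -> bool})
      (1 + a ^+ 2 * rdot R xi eta) ^+ n)%:E); last first.
  rewrite mulr_sumr -sumEFin; apply: eq_bigr => xi _.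
  rewrite mulr_sumr -sumEFin; apply: eq_bigr => eta _.
  rewrite (integral_pertM mphi phi_mean0 phi_orth mpsi psiB psiphi a0).
  by rewrite -EFin_expe -EFinM.
have chi : b ^+ 2 * K ^- 2 * \sum_(xi : {ffun 'I_N -> bool})
    \sum_(eta : {ffun 'I_N -> bool}) (1 + a ^+ 2 * rdot R xi eta) ^+ n <= b ^+ 2 * D.
  rewrite -mulrA ler_wpM2l ?sqr_ge0//.
  rewrite ler_pdivrMl ?exprn_gt0//.
  apply: (le_trans (rademacher_chi2 _ _)).
  - by rewrite ger0_norm// mulr_ge0// sqr_ge0.
  (* [1 + a^2 <xi, eta>] is the integral of a product of two densities, hence nonnegative. *)
  - move=> xi eta; rewrite -lee_fin.
    rewrite -(integral_pertM mphi phi_mean0 phi_orth mpsi psiB psiphi a0).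
    by apply: integral_ge0 => x _; rewrite lee_fin mulr_ge0//; exact: p0.
  - have -> : 4 ^+ N = (2 ^+ N) ^+ 2 :> R.
      by rewrite -exprM mulnC exprM; congr (_ ^+ _); ring.
    by rewrite KE ler_wpM2l ?exprn_ge0.
(* With an infinite supremum the bound is trivial; finiteness is then used to average the constant
   [S]. *)
have [Soo|Sfin] := eqVneq S +oo%E.
  by move=> _; rewrite Soo addey ?leey// gt_eqF// (lt_le_trans _ E0)// ltNy0.
have {}Sfin : S \is a fin_num by rewrite ge0_fin_numE// lt_neqAle Sfin leey.
have avg : (\sum_xi (K^-1)%:E * iter_int (P xi) (fun t => (1 - T t)%:E) <= S)%E.
  apply: (@le_trans _ _ (\sum_(xi : {ffun 'I_N -> bool}) (K^-1)%:E * S)%E).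
    by apply: lee_sum => xi _; apply: lee_wpmul2l => //; rewrite lee_fin invr_ge0 ltW.
  rewrite -(fineK Sfin); under eq_bigr do rewrite -EFinM.
  rewrite sumEFin sumr_const -mulr_natl mulrA mulfV ?mul1r// gt_eqF//.
move=> H.
have H2 : ((2 * b)%:E <= E + S + (b ^+ 2 * D)%:E)%E.
  apply: le_trans H _; apply: leeD; last by rewrite lee_fin.
  exact: leeD2l.
have -> : 3 / 4 / D = 2 * b - b ^+ 2 * D.
  by rewrite /b; field; rewrite gt_eqF.
by rewrite EFinB leeBlDr.
Qed.

End FixedSample.

(** * Choice of dimension, amplitude and radius *)

Section Rates.
Set Implicit Arguments.
Unset Strict Implicit.
Unset Printing Implicit Defensive.
Variable R : realType.

Lemma powR_ge_near_pinfty (e c : R) : 0 < e ->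
  exists y0 : R, 0 < y0 /\ forall y, y0 <= y -> c <= y `^ e.
Proof.
move=> e0; set m := Num.max c 1.
have m0 : 0 < m by rewrite lt_max ltr01 orbT.
exists (m `^ (1 / e)); split => [|y yy]; first exact: powR_gt0.
apply: (@le_trans _ _ m); first by rewrite le_max lexx.
have <- : (m `^ (1 / e)) `^ e = m.
  by rewrite -powRrM div1r mulVf ?powRr1 ?gt_eqF// ltW.
apply: ge0_ler_powR => //; first exact: ltW.
- by rewrite nnegrE powR_ge0.
- by rewrite nnegrE (le_trans _ yy)// powR_ge0.
Qed.

(** [(M / sqrt C)^theta] gives equality in the last condition, whose right side decreases in [h];
    hence the minimum with [M], which meets the bound for [theta = 0], still satisfies it. *)
Lemma rkhs_radius_choice (theta M C : R) :
  0 <= theta -> 0 < M -> 0 < C -> exists h : R,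
  [/\ 0 < h, h <= M & theta != 0 -> Num.sqrt C <= M * h `^ (- (1 / theta))].
Proof.
move=> theta0 M0 C0; have sC0 : 0 < Num.sqrt C by rewrite sqrtr_gt0.
set q := (M / Num.sqrt C) `^ theta.
have q0 : 0 < q by rewrite powR_gt0// divr_gt0.
exists (Num.min M q); split; [by rewrite lt_min M0|by rewrite ge_min lexx|].
move=> tn0; have t0 : 0 < theta by rewrite lt_neqAle eq_sym tn0.
have h0 : 0 < Num.min M q by rewrite lt_min M0.
rewrite powRN ler_pdivlMr ?powR_gt0// mulrC -ler_pdivlMr//.
apply: (@le_trans _ _ (q `^ (1 / theta))).
  apply: ge0_ler_powR; rewrite ?nnegrE ?divr_ge0 ?(ltW h0) ?(ltW q0)//.
  by rewrite ge_min lexx orbT.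
rewrite -powRrM mulrA mulr1 mulfV// powRr1// divr_ge0// ltW//.
Qed.

(* Here [y] stands for [n^(1/(4s+theta+1))]; the radius is [rho = h y^(2 s theta)] and
   [N ~ A y^(2(1+theta))], where [A] solves [C A^(2s) / c0 = h^2]. *)
Lemma rate_choice (s theta M C c0 B : R) (k0 : nat) :
  1 / 2 < s -> 0 <= theta -> theta < 2 * s - 1 ->
  0 < M -> 0 < C -> 0 < c0 -> 0 <= B ->
  exists D y0 : R, [/\ 1 <= D, 0 < y0 &
  forall y, y0 <= y -> exists (N : nat) (a rho : R),
  [/\ [/\ (k0 < N)%N, 0 <= a, a ^+ 2 * N%:R = C * y `^ (- (4 * s)),
        a * N%:R * B <= 1 & y `^ (4 * s + theta + 1) * a ^+ 2 <= 1 / 2],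
      expR (2 * (y `^ (4 * s + theta + 1) * a ^+ 2) ^+ 2 * N%:R) <= D &
      [/\ 0 < rho, a ^+ 2 * N%:R * (N%:R `^ (2 * s) / c0) <= rho ^+ 2,
        theta = 0 -> rho <= M &
        theta != 0 -> Num.sqrt (a ^+ 2 * N%:R) <= M * rho `^ (- (1 / theta))]]].
Proof.
move=> s12 theta0 theta1 M0 C0 c00 B0.
have [h [h0 hM hC]] := rkhs_radius_choice theta0 M0 C0.
have s0 : 0 < s by lra.
pose A := (h ^+ 2 * c0 / C) `^ (1 / (2 * s)).
have hcC0 : 0 < h ^+ 2 * c0 / C by rewrite divr_gt0// mulr_gt0// exprn_gt0.
have A0 : 0 < A by exact: powR_gt0.
have A2s : A `^ (2 * s) = h ^+ 2 * c0 / C.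
  by rewrite -powRrM div1r mulVf ?powRr1 ?ltW// gt_eqF// mulr_gt0.
pose kap := 2 * (1 + theta).
(* Beyond [y1], [A y^kap >= 2 (k0 + 1)], so rounding down keeps [N > k0] and loses at most half of
   [A y^kap]. *)
have [y1 [y1_gt0 y1P]] := @powR_ge_near_pinfty kap ((2 * k0.+1%:R) / A) ltac:(rewrite /kap; lra).
(* Beyond [y2], [(a N B)^2 <= C A B^2 y^(kap - 4 s) <= 1]; the exponent is negative exactly because
   [theta < 2 s - 1]. *)
have [y2 [y2_gt0 y2P]] :=
  @powR_ge_near_pinfty (4 * s - kap) (C * A * B ^+ 2) ltac:(rewrite /kap; lra).
(* Beyond [y3], [y^(4 s + theta + 1) a^2 = C y^(1 + theta) / N <= 2 C / (A y^(1 + theta)) <= 1 /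
   2]. *)
have [y3 [y3_gt0 y3P]] := @powR_ge_near_pinfty (1 + theta) (4 * C / A) ltac:(lra).
(* The exponent to bound is [2 C^2 y^kap / N], and [N >= A y^kap / 2]. *)
exists (expR (4 * C ^+ 2 / A)), (Num.max y1 (Num.max y2 y3)); split.
- by rewrite -expR0 ler_expR divr_ge0 ?mulr_ge0 ?sqr_ge0// ltW.
- by rewrite lt_max y1_gt0.
move=> y; rewrite !ge_max => /andP[y1y /andP[/y2P {}y2P /y3P {}y3P]].
have Yk := y1P _ y1y; have y0 := lt_le_trans y1_gt0 y1y.
have Y0 e : 0 < y `^ e by exact: powR_gt0.
have YD e f : y `^ (e + f) = y `^ e * y `^ f by rewrite powRD// (gt_eqF y0) implybT.
rewrite ler_pdivrMr// mulrC in Yk.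
set Yk' := y `^ kap in Yk *.
pose N := Num.truncn (A * Yk').
have Yk0 : 0 < Yk' by exact: Y0.
have AY0 : 0 < A * Yk' by exact: mulr_gt0.
have /andP[NA AN] := truncn_itv (ltW AY0); rewrite -/N in NA AN.
have k01 : 1 <= k0.+1%:R :> R by rewrite ler1n.
have AN2 : A * Yk' / 2 <= N%:R.
  by rewrite -natr1 in AN; lra.
have k0N : (k0 < N)%N by rewrite -(ler_nat R); lra.
have N0 : 0 < N%:R :> R by rewrite ltr0n (leq_trans _ k0N).
pose V := C * y `^ (- (4 * s)).
have V0 : 0 < V by rewrite mulr_gt0.
have a2 : Num.sqrt (V / N%:R) ^+ 2 = V / N%:R.
  by rewrite sqr_sqrtr// divr_ge0 ?ltW.
have a2N : V / N%:R * N%:R = V by rewrite divfK// gt_eqF.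
have Yk2 : Yk' = (y `^ (1 + theta)) ^+ 2.
  by rewrite /Yk' /kap -powR_mulrn ?powR_ge0// -powRrM mulrC.
have YL : y `^ (4 * s + theta + 1) * y `^ (- (4 * s)) = y `^ (1 + theta).
  by rewrite -YD; congr (_ `^ _); ring.
exists N, (Num.sqrt (V / N%:R)), (h * y `^ (2 * s * theta)).
rewrite a2 a2N; split.
- split => //.
  + apply: (@le_trans _ _ (Num.sqrt ((V / N%:R * N%:R) * N%:R * B ^+ 2))).
      have -> : V / N%:R * N%:R * N%:R * B ^+ 2 = V / N%:R * (N%:R * B) ^+ 2 by ring.
      rewrite (sqrtrM ((N%:R * B) ^+ 2)); last exact: divr_ge0 (ltW V0) (ltW N0).
      by rewrite sqrtr_sqr ger0_norm ?mulrA// mulr_ge0 ?(ltW N0).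
    rewrite -[leRHS]sqrtr1 ler_sqrt// a2N.
    apply: (@le_trans _ _ (V * (A * Yk') * B ^+ 2)).
      by rewrite ler_wpM2r ?sqr_ge0// ler_wpM2l// ltW.
    rewrite [leLHS](_ : _ = (C * A * B ^+ 2) * (Yk' * y `^ (- (4 * s)))); last first.
      by rewrite /V; ring.
    rewrite -YD [in leLHS](_ : kap + _ = - (4 * s - kap)); last by ring.
    by rewrite powRN ler_pdivrMr// mul1r.
  + rewrite mulrA ler_pdivrMr// /V (mulrCA _ C) YL.
    apply: le_trans (_ : A * Yk' / 2 / 2 <= _); last by lra.
    rewrite ler_pdivrMr// mulrC in y3P.
    have := Y0 (1 + theta); rewrite Yk2; nra.
- rewrite ler_expR.
  rewrite [leLHS](_ : _ = 2 * (y `^ (4 * s + theta + 1) * V) ^+ 2 / N%:R); last first.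
    by field; rewrite gt_eqF.
  rewrite /V (mulrCA _ C) YL exprMn -Yk2 ler_pdivrMr//.
  apply: (@le_trans _ _ (4 * C ^+ 2 / A * (A * Yk' / 2))); last first.
    by rewrite ler_wpM2l// divr_ge0 ?mulr_ge0 ?sqr_ge0// ltW.
  by rewrite le_eqVlt; apply/orP; left; apply/eqP; field; rewrite gt_eqF.
split.
- by rewrite mulr_gt0.
(* After [N] is replaced by its upper bound, the choice of [A] turns the left side into
   [h^2 y^(4 s theta)], which is exactly [rho ^+ 2]. *)
- apply: (@le_trans _ _ (V * ((A * Yk') `^ (2 * s) / c0))).
    rewrite ler_wpM2l ?(ltW V0)// ler_wpM2r ?invr_ge0 ?(ltW c00)//.
    apply: ge0_ler_powR => //; rewrite ?nnegrE; [lra|exact: ltW|exact: ltW].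
  rewrite powRM ?(ltW A0) ?powR_ge0// A2s /V.
  rewrite [leLHS](_ : _ = h ^+ 2 * (y `^ (- (4 * s)) * Yk' `^ (2 * s))); last first.
    by field; rewrite !gt_eqF.
  rewrite exprMn /Yk' -powRrM -YD -(powR_mulrn 2 (powR_ge0 y _)) -powRrM.
  rewrite le_eqVlt; apply/orP; left; apply/eqP; congr (_ * _ `^ _).
  by rewrite /kap; ring.
- by move=> ->; rewrite mulr0 powRr0 mulr1.
(* Both sides carry the factor [y^(- 2 s)], which leaves the defining inequality of [h]. *)
- move=> tn0; rewrite powRM ?(ltW h0) ?powR_ge0// -powRrM mulrA.
  rewrite [in leRHS](_ : 2 * s * theta * _ = - (2 * s)); last by field.
  rewrite /V (_ : y `^ (- (4 * s)) = (y `^ (- (2 * s))) ^+ 2).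
    by rewrite sqrtrM ?(ltW C0)// sqrtr_sqr ger0_norm ?powR_ge0// ler_wpM2r ?powR_ge0// hC.
  by rewrite -powR_mulrn ?powR_ge0// -powRrM; congr (_ `^ _); ring.
Qed.

End Rates.

(** * Asymptotic lower bound along [y = n^(1/L)] *)

Theorem theorem4 (d : measure_display) (X : measurableType d) (R : realType)
    (P0 : probability X R) (K : X -> X -> R) (lam : nat -> R) (phi : nat -> X -> R)
    (s : R)
    (Hs : 1 / 2 < s)
    (Hlam_pos : forall k, 0 < lam k)
    (Hlam_decr : forall k, lam k.+1 < lam k)
    (Hlam_inf : (0 < limn_einf (fun k => ((k.+1%:R `^ (2 * s) * lam k)%:E)))%E)
    (Hlam_sup : (limn_esup (fun k => ((k.+1%:R `^ (2 * s) * lam k)%:E)) < +oo)%E)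
    (Hphi_meas : forall k, measurable_fun setT (phi k))
    (Hphi_mean0 : forall k, Rintegral P0 setT (phi k) = 0)
    (Hphi_orth : forall j k,
        L2ip P0 (phi j) (phi k) = if j == k then 1 else 0)
    (Hphi_complete : forall f : X -> R, L2 P0 f -> Rintegral P0 setT f = 0 ->
        (forall k, L2ip P0 f (phi k) = 0) -> L2norm P0 f = 0)
    (Hphi_bdd : exists B : R, forall k, {ae P0, forall x, `|phi k x| <= B})
    (HMercer : forall x x',
        series (fun k => lam k * phi k x * phi k x') @ \oo --> K x x')
    (M theta : R) (HM : 0 < M) (Htheta0 : 0 <= theta) (Htheta1 : theta < 2 * s - 1)
    (Delta : nat -> R)
    (HDelta : (limn_esup (fun n =>
        ((Delta n * n%:R `^ (4 * s / (4 * s + theta + 1)))%:E)) < +oo)%E) :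
  (0 < limn_einf (fun n => minimax_risk P0 lam phi n (Delta n) theta M))%E.
Proof.
have [B phiB] := Hphi_bdd.
have [psi [mpsi psiB psiphi]] := bounded_version Hphi_meas phiB.
have [c0 [k0 [c00 lamc0]]] := limn_einf_gt0P Hlam_inf.
have [C1 [n0 DC1]] := limn_esup_ltyP HDelta.
(* The eventual bound [C1] may be nonpositive, while the perturbation needs [C > 0]. *)
pose C := Num.max C1 1.
have C0 : 0 < C by rewrite lt_max ltr01 orbT.
have [D [y0 [D1 y00 rate]]] :=
  rate_choice k0 Hs Htheta0 Htheta1 HM C0 c00 (normr_ge0 B).
set L := 4 * s + theta + 1 in rate HDelta DC1 *.
have L0 : 0 < L by rewrite /L; lra.
apply: (@lt_le_trans _ _ (3 / 4 / D)%:E).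
  by rewrite lte_fin divr_gt0 ?(lt_le_trans ltr01 D1).
(* The second term of the maximum forces [n^(1/L) >= y0] and also [n > 0]. *)
apply: (le_limn_einf (k0 := maxn n0 (Num.truncn (y0 `^ L)).+1)) => n.
rewrite geq_max => /andP[nn0 yn].
have n_gt0 : 0 < n%:R :> R by rewrite ltr0n (leq_trans _ yn).
have y0n : y0 <= n%:R `^ (1 / L).
  have -> : y0 = (y0 `^ L) `^ (1 / L).
    by rewrite -powRrM mul1r mulfV ?gt_eqF// powRr1// ltW.
  apply: ge0_ler_powR; rewrite ?nnegrE ?powR_ge0 ?ler0n// ?divr_ge0 ?(ltW L0)//.
  have /andP[_ /ltW/le_trans] := truncn_itv (powR_ge0 y0 L).
  by apply; rewrite ler_nat.
have [N [a [rho [[k0N a0 aN aNB na] chi [rho0 arho rhoM arhoM]]]]] := rate _ y0n.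
have yL : (n%:R `^ (1 / L)) `^ L = n%:R.
  by rewrite -powRrM mul1r mulVf ?gt_eqF// powRr1.
rewrite yL in na chi.
have lamN (k : 'I_N) : lam N.-1 <= lam k.
  have /nonincreasing_seqP : forall k, lam k.+1 <= lam k by move=> i; exact: ltW.
  by apply; rewrite -ltnS prednK// (leq_ltn_trans _ k0N).
(* Eigenvalues are indexed from 0, so [lam N.-1] is paired with [N^(2 s)]; [k0 < N] gives
   [k0 <= N.-1], hence [1 / lam N.-1 <= N^(2 s) / c0]. *)
have NlamN : a ^+ 2 * N%:R / lam N.-1 <= rho ^+ 2.
  apply: le_trans arho; rewrite ler_wpM2l ?mulr_ge0 ?sqr_ge0//.
  have N1 : N.-1.+1 = N by rewrite prednK// (leq_ltn_trans _ k0N).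
  rewrite ler_pdivlMr// mulrC ler_pdivrMr//.
  by have := lamc0 N.-1; rewrite N1 -ltnS N1; exact.
apply: (minimax_risk_ge Hphi_meas Hphi_mean0 Hphi_orth mpsi psiB psiphi a0 aNB na D1 chi).
- rewrite aN -powRrM (_ : 1 / L * - (4 * s) = - (4 * s / L)); last by ring.
  rewrite powRN ler_pdivlMr ?powR_gt0//.
  by apply: le_trans (DC1 _ nn0) _; rewrite le_max lexx.
- move=> xi.
  have [inH normH] :=
    pert_inRKHS Hphi_meas Hphi_mean0 Hphi_orth mpsi psiB psiphi a0 xi Hlam_pos.
  apply: (Fclass_ball (rho := rho)) => //.
  + rewrite normH -[leRHS](ger0_norm (ltW rho0)) -sqrtr_sqr ler_wsqrtr//.
    apply: le_trans NlamN.
    (* Every eigenvalue in use is at least the last one, [lam N.-1]. *)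
    apply: (@le_trans _ _ (\sum_(k < N) a ^+ 2 / lam N.-1)).
      by apply: ler_sum => k _; rewrite ler_wpM2l ?sqr_ge0// lef_pV2 ?posrE.
    by rewrite sumr_const card_ord -[leLHS]mulr_natr mulrAC.
  + move=> tn0; apply: le_trans (arhoM tn0).
    rewrite -(L2norm_pert_sqr Hphi_meas Hphi_orth mpsi psiB psiphi a0 xi).
    by rewrite sqrtr_sqr ler_norm.
Qed.
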